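(* Let $F=\lambda I+H\colon\mathbb{R}^3\to\mathbb{R}^3$, where $$H(x,y,z)=g(z)\,(a(z)x+b(z)y)\begin{pmatrix}-b(z)\\ a(z)\\ 0\end{pmatrix},$$ with $\lambda<0$, $a,b,g\in\mathbb{R}[z]$ and $F(0)=0$. Then there exists a related bidimensional nonautonomous linear system $$\dot u=C(t)u$$ which has an exponential dichotomy with projector $P=I$ on $\mathbb{R}^+$, with $\Sigma^+_{ED}(C)=\{\lambda\}$. Moreover, $F$ has the origin as global attractor.
   Context: $\mathbb{R}^+=[0,+\infty)$; $\mathbb{R}[z]$ is the set of real polynomials in the variable $z$; in $F=\lambda I+H$, $I$ is the identity map of $\mathbb{R}^3$, and in $P=I$ it is the $2\times 2$ identity matrix. The word ''related'' is informal: the statement does not specify $C(t)$ further. Exponential dichotomy: let $J\subset\mathbb{R}$ and let $t\mapsto M(t)$ be a locally integrable matrix function. The system $\dot x=M(t)x$, with fundamental matrix $\Phi(t)$, has an exponential dichotomy on $J$ with projector $P$ if $P^2=P$ and there are constants $K\ge 1$, $\alpha>0$ such that $\|\Phi(t)P\Phi^{-1}(s)\|\le Ke^{-\alpha(t-s)}$ for all $t\ge s$, $t,s\in J$, and $\|\Phi(t)(I-P)\Phi^{-1}(s)\|\le Ke^{-\alpha(s-t)}$ for all $s\ge t$, $t,s\in J$. It has an exponential dichotomy on $J$ if such a projector exists. Exponential dichotomy spectrum on $\mathbb{R}^+$: $\Sigma^+_{ED}(M)$ is the set of $\gamma\in\mathbb{R}$ such that $\dot x=[M(t)-\gamma I]x$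 does not have an exponential dichotomy on $[0,+\infty)$. ''$F$ has the origin as global attractor'' means that the origin is a global attractor of the autonomous system $(\dot x,\dot y,\dot z)=F(x,y,z)$, i.e. every solution converges to the origin as $t\to+\infty$. *)

(* Defs.v *)
From HB Require Import structures.
From mathcomp Require Import all_boot all_order all_algebra.
From mathcomp Require Import all_classical all_reals all_analysis.
Set Implicit Arguments.
Unset Strict Implicit.
Unset Printing Implicit Defensive.
Import Order.TTheory GRing.Theory Num.Theory.
Import numFieldTopology.Exports numFieldNormedType.Exports.
Local Open Scope classical_set_scope.
Local Open Scope ring_scope.

Definition locally_integrable_mx (R : realType) (m n : nat) (J : interval R)
    (M : R -> 'M[R]_(m, n)) : Prop :=
  forall s t, s \in J -> t \in J -> forall i j,
    lebesgue_measure.-integrable `[s, t] (fun r => (M r i j)%:E).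

(* For a locally integrable M, x' = M(t) x is understood in the sense of
   Caratheodory, i.e. through the equivalent integral equation, entry by
   entry. *)
Definition fundamental_matrix (R : realType) (n : nat) (J : interval R)
    (M Phi : R -> 'M[R]_n) : Prop :=
  [/\ forall t, t \in J -> Phi t \in unitmx,
      locally_integrable_mx J (fun t => M t *m Phi t)
    & forall s t, s \in J -> t \in J -> s <= t -> forall i j,
        Phi t i j = Phi s i j
          + \int[lebesgue_measure]_(r in `[s, t]) (M r *m Phi r) i j].

(* `|A| is the library's norm on matrices, max_ij |A_ij|; in finite dimension
   another norm only changes the constant K. *)
Definition exp_dichotomy_with (R : realType) (n : nat) (J : interval R)
    (M : R -> 'M[R]_n) (P : 'M[R]_n) : Prop :=
  P *m P = P /\
  exists Phi : R -> 'M[R]_n, fundamental_matrix J M Phi /\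
  exists K alpha : R, [/\ 1 <= K, 0 < alpha,
    forall t s, t \in J -> s \in J -> s <= t ->
      `|Phi t *m P *m invmx (Phi s)| <= K * expR (- (alpha * (t - s)))
  & forall t s, t \in J -> s \in J -> t <= s ->
      `|Phi t *m (1%:M - P) *m invmx (Phi s)| <= K * expR (- (alpha * (s - t)))].

Definition exp_dichotomy (R : realType) (n : nat) (J : interval R)
    (M : R -> 'M[R]_n) : Prop :=
  exists P, exp_dichotomy_with J M P.

Definition ED_spectrum_plus (R : realType) (n : nat) (M : R -> 'M[R]_n) :
    set R :=
  [set gamma | ~ exp_dichotomy `[0, +oo[%R (fun t => M t - gamma%:M)].

(* The derivative at 0 is not required: by continuity of X and F, X then has
   right derivative F (X 0) at 0. *)
Definition solution_Rplus (R : realType) (n : nat)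
    (F : 'cV[R]_n -> 'cV[R]_n) (X : R -> 'cV[R]_n) : Prop :=
  {within `[0, +oo[, continuous X} /\
  forall t : R, 0 < t -> is_derive t 1 X (F (X t)).

(* The first conjunct excludes blow-up in finite time. *)
Definition origin_global_attractor (R : realType) (n : nat)
    (F : 'cV[R]_n -> 'cV[R]_n) : Prop :=
  (forall p, exists X, solution_Rplus F X /\ X 0 = p) /\
  (forall X, solution_Rplus F X -> X t @[t --> +oo] --> (0 : 'cV[R]_n)).

Definition Hfield (R : realType) (a b g : {poly R}) (p : 'cV[R]_3) :
    'cV[R]_3 :=
  let x := p 0 0 in let y := p 1 0 in let z := p 2 0 in
  (g.[z] * (a.[z] * x + b.[z] * y)) *:
    \col_(i < 3) [:: - b.[z]; a.[z]; 0]`_i.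

Definition pt3 (R : realType) (u : 'cV[R]_2) (z : R) : 'cV[R]_3 :=
  \col_(i < 3) [:: u 0 0; u 1 0; z]`_i.

(* u' = C(t) u is obtained from (x,y,z)' = F(x,y,z) by substituting, in the
   first two equations, the solution z of the third one with z(0) = z0, where
   the third equation does not involve (x,y). *)
Definition related_system (R : realType) (F : 'cV[R]_3 -> 'cV[R]_3) (z0 : R)
    (C : R -> 'M[R]_2) : Prop :=
  exists z : R -> R,
  [/\ z 0 = z0, {within `[0, +oo[, continuous z},
      forall (t : R) u, 0 < t -> is_derive t 1 z (F (pt3 u (z t)) 2 0)
    & forall (t : R) u, 0 <= t ->
        C t *m u = \col_(i < 2) F (pt3 u (z t)) (widen_ord (leqnSn 2) i) 0].

(* Main.v *)
Require Import Defs.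
From HB Require Import structures.
From mathcomp Require Import all_boot all_order all_algebra.
From mathcomp Require Import all_classical all_reals all_analysis.
From mathcomp Require Import measurable_realfun.
From mathcomp Require Import ring lra.
Set Implicit Arguments.
Unset Strict Implicit.
Unset Printing Implicit Defensive.

Import Order.TTheory GRing.Theory Num.Theory.
Import numFieldTopology.Exports numFieldNormedType.Exports.
Local Open Scope classical_set_scope.
Local Open Scope ring_scope.

(** Why the theorem is true. The third equation is [z' = lambda z], so along a
solution [z(t) = z0 exp(lambda t)], and the first two equations become the
linear system [u' = (lambda I + P(z(t))) u], where [P(z)] is [g(z)] times the
column [(-b(z), a(z))] times the row [(a(z), b(z))]. The row is orthogonal to
the column, hence [P(z)^2 = 0] for each [z]; but the matrices [P(z(t))] for
different [t] do not commute, so no closed formula for the solutions is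
available. Instead, [P(z(t))] converges exponentially fast to the square-zero
matrix [N = P(0)], which need not vanish.

Such a perturbation changes no exponential rate. For any [eps > 0] the energy
[Q(x) = eps^2 |x|^2 + |N x|^2] has, along [x' = mu x + N x], a relative rate of
change within [eps] of [2 mu], since [2 eps^2 <x, N x> <= eps Q(x)] and
[N (N x) = 0]. An error of size [O(exp(lambda t))] in the matrix adds an
integrable term to this rate, which costs a constant factor only. By Gronwall's
inequality in both time directions, [x(t)] is bounded by a constant times
[exp(mu (t - s) + eps |t - s|) |x(s)|] for all [s, t >= 0], in either order:
this is the property [bohl_exponent], obtained in [bohl_exponent_of_limit].

Everything follows from this two-sided estimate. A shift by [gamma] moves the
exponent from [lambda] to [lambda - gamma]. If it is negative, the transition
matrix decays forward in time and [P = I] is a dichotomy projector; if it is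
positive, [P = 0] is one. If it is zero, the subexponential growth of solutions
contradicts the exponential estimates of a dichotomy, whatever its projector
and fundamental matrix. So the spectrum is [{lambda}]
([ED_spectrum_plus_bohl]). Taking [gamma = 0], the estimate also gives
[u(t) -> 0], and [z(t) -> 0] explicitly, which is global attraction.

A fundamental matrix is constructed by Picard iteration
([linear_solution_exists]). A fundamental matrix in the integral sense has a
continuous integrand a posteriori, hence is a classical solution
([linear_solution_of_integral]), so that the estimate applies to it too. *)

(** * Entrywise calculus of matrices *)

Lemma entry_le_norm (R : realType) m n (A : 'M[R]_(m, n)) i j :
  `|A i j| <= `|A|.
Proof.
by rewrite [leRHS]/Num.Def.normr/= mx_normrE (le_bigmax _ _ (i, j)).
Qed.

Lemma norm_mx_le (R : realType) m n (A : 'M[R]_(m, n)) (c : R) :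
  0 <= c -> (forall i j, `|A i j| <= c) -> `|A| <= c.
Proof.
by move=> c0 Ac; rewrite [leLHS]/Num.Def.normr/= mx_normrE bigmax_le.
Qed.

Lemma norm_mulmx_le (R : realType) m n p (A : 'M[R]_(m, n)) (B : 'M[R]_(n, p)) :
  `|A *m B| <= n%:R * `|A| * `|B|.
Proof.
apply: norm_mx_le => [|i j]; first by rewrite !mulr_ge0.
rewrite mxE (le_trans (ler_norm_sum _ _ _))//.
rewrite -mulrA mulr_natl -[X in _ *+ X]card_ord -sumr_const ler_sum// => k _.
by rewrite normrM ler_pM// entry_le_norm.
Qed.

Lemma is_derive_entries (R : realType) m n (X : R -> 'M[R]_(m, n))
    (t : R) (D : 'M[R]_(m, n)) :
  is_derive t 1 X D <->
  forall i j, is_derive t 1 (fun s => X s i j) (D i j).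
Proof.
split=> [[dX <-] i j|dX].
  by split; [exact: (derivable_mxP X t 1).1|rewrite derive_mx// mxE].
have dX1 : derivable X t 1 by apply/derivable_mxP => i j; have [] := dX i j.
split=> //; rewrite derive_mx//; apply/matrixP => i j; rewrite mxE.
by have [] := dX i j.
Qed.

Lemma cvg_entries (R : realType) m n (T : Type) (Fi : set_system T)
    (FF : Filter Fi) (X : T -> 'M[R]_(m, n)) (L : 'M[R]_(m, n)) :
  X @ Fi --> L <-> forall i j, (fun s => X s i j) @ Fi --> L i j.
Proof.
split=> [XL i j|XL].
  apply/cvgrPdist_le => e e0; move/cvgrPdist_le : XL => /(_ e e0).
  apply: filterS => s; apply: le_trans.
  by rewrite (le_trans _ (entry_le_norm _ i j))// !mxE.
apply/cvgrPdist_le => e e0; near=> s; apply: norm_mx_le => [|i j].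
  exact: ltW.
rewrite !mxE; move: i j; near: s.
apply: filter_forall => i; apply: filter_forall => j.
by move/cvgrPdist_le : (XL i j) => /(_ e e0).
Unshelve. all: by end_near. Qed.

Lemma continuous_entries (R : realType) m n (A : set R)
    (X : R -> 'M[R]_(m, n)) :
  {within A, continuous X} <->
  forall i j, {within A, continuous (fun s => X s i j)}.
Proof.
split=> [cX i j t|cX t].
  by have /cvg_entries/(_ i j) := cX t.
by apply/cvg_entries => i j; exact: cX.
Qed.

(** * Growth of solutions of linear systems *)

(** [X] is matrix-valued, so that one definition covers vector solutions and
fundamental matrices. As in [solution_Rplus], no derivative is required at the
endpoint 0, where solutions built from integrals only have a right one. *)
Definition linear_solution (R : realType) n p (M : R -> 'M[R]_n)
    (X : R -> 'M[R]_(n, p)) : Prop :=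
  {within `[0, +oo[, continuous X} /\
  forall t : R, 0 < t -> is_derive t 1 X (M t *m X t).

(** The lower and upper Bohl exponents of the system are both [mu]. As [s] and
[t] come in either order, the case [t < s] bounds solutions from below. *)
Definition bohl_exponent (R : realType) n (M : R -> 'M[R]_n) (mu : R) : Prop :=
  forall eps : R, 0 < eps -> exists2 K, 1 <= K &
    forall x : R -> 'cV[R]_n, linear_solution M x ->
    forall s t : R, 0 <= s -> 0 <= t ->
      `|x t| <= K * expR (mu * (t - s) + eps * `|t - s|) * `|x s|.

(** The product [q exp(-h)] is nonincreasing. The sign of [q] is free, which
lets the lower bound be deduced by passing to [-q]. *)
Lemma gronwall_upper (R : realType) (q dq h k : R -> R) :
  {within `[0, +oo[, continuous q} -> {within `[0, +oo[, continuous h} ->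
  (forall t : R, 0 < t -> is_derive t 1 q (dq t)) ->
  (forall t : R, 0 < t -> is_derive t 1 h (k t)) ->
  (forall t : R, 0 < t -> dq t <= k t * q t) ->
  forall s t : R, 0 <= s -> s <= t -> q t <= q s * expR (h t - h s).
Proof.
move=> cq ch dqE dhE le_dq s t s0 st.
pose f : R -> R := q * (expR \o (- h)).
have df (r : R) : 0 < r -> is_derive r 1 f ((dq r - k r * q r) * expR (- h r)).
  move=> r0; have := dqE r r0; have := dhE r r0 => dh dq'.
  have e1 : is_derive r 1 (expR \o (- h)) (expR (- h r) * - k r).
    have dN : is_derive r 1 (- h) (- k r) by exact: is_deriveN.
    exact: (@is_derive1_comp R expR (- h) r).
  apply: is_derive_eq.
  by rewrite /GRing.scale/= fctE/=; ring.
have cf : {within `[0, +oo[, continuous f}.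
  move=> r; apply: cvgM; first exact: cq.
  apply: (@cvg_comp _ _ _ (- h) expR); last exact: continuous_expR.
  exact: (cvgN (ch r)).
have : f t <= f s.
  apply: (@ler0_derive1_nincry _ f 0) => // r; rewrite in_itv/= andbT => r0.
    by have [] := df r r0.
  rewrite derive1E; have [_ ->] := df r r0.
  by rewrite mulr_le0_ge0 ?expR_ge0// subr_le0 le_dq.
rewrite /f !fctE/= !expRN => H.
rewrite expRD expRN mulrCA -ler_pdivrMl ?expR_gt0// mulrC.
exact: H.
Qed.

Lemma gronwall_lower (R : realType) (q dq h k : R -> R) :
  {within `[0, +oo[, continuous q} -> {within `[0, +oo[, continuous h} ->
  (forall t : R, 0 < t -> is_derive t 1 q (dq t)) ->
  (forall t : R, 0 < t -> is_derive t 1 h (k t)) ->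
  (forall t : R, 0 < t -> k t * q t <= dq t) ->
  forall s t : R, 0 <= s -> s <= t -> q s * expR (h t - h s) <= q t.
Proof.
move=> cq ch dqE dhE le_dq s t s0 st.
rewrite -lerN2 -mulNr.
apply: (@gronwall_upper _ (- q) (- dq) h k) => //.
- by move=> r; apply: cvgN; exact: cq.
- by move=> r r0; apply: is_deriveN; exact: dqE.
- by move=> r r0; rewrite mulrN lerN2 le_dq.
Qed.

Lemma is_derive_expRM (R : realType) (lambda t : R) :
  is_derive t 1 (fun s => expR (lambda * s)) (lambda * expR (lambda * t)).
Proof.
have dl : is_derive t 1 (fun s : R => lambda * s) lambda.
  rewrite (_ : (fun s : R => _) = lambda *: id)//; apply: is_derive_eq.
  by rewrite /GRing.scale/= mulr1.
by rewrite mulrC; exact: (@is_derive1_comp R expR (fun s => lambda * s) t).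
Qed.

Lemma is_derive_continuous (R : realType) (f : R -> R) (t d : R) :
  is_derive t 1 f d -> {for t, continuous f}.
Proof.
by move=> [df _]; apply: differentiable_continuous; exact/derivable1_diffP.
Qed.

Lemma continuous_expRM (R : realType) (lambda : R) :
  continuous (fun t : R => expR (lambda * t)).
Proof. by move=> t; exact: is_derive_continuous (is_derive_expRM lambda t). Qed.

(** Each entry of a linear image is a fixed linear combination of entries, which
transports entrywise calculus through left and right multiplications alike. *)
Lemma linear_mx_entry (R : realType) m n p q
    (f : {linear 'M[R]_(m, n) -> 'M[R]_(p, q)}) (A : 'M[R]_(m, n)) k l :
  f A k l = \sum_i \sum_j f (delta_mx i j) k l * A i j.
Proof.
rewrite {1}[A]matrix_sum_delta linear_sum summxE; apply: eq_bigr => i _.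
rewrite linear_sum summxE; apply: eq_bigr => j _.
by rewrite linearZ mxE mulrC.
Qed.

Lemma is_derive_linear_mx (R : realType) m n p q
    (f : {linear 'M[R]_(m, n) -> 'M[R]_(p, q)}) (X : R -> 'M[R]_(m, n))
    (t : R) (D : 'M[R]_(m, n)) :
  is_derive t 1 X D -> is_derive t 1 (fun s => f (X s)) (f D).
Proof.
move=> /is_derive_entries dX; apply/is_derive_entries => k l.
rewrite (_ : (fun s => _) = \sum_i \sum_j
    (f (delta_mx i j) k l *: (fun s => X s i j))); last first.
  apply/funext => s; rewrite linear_mx_entry fct_sumE.
  by apply: eq_bigr => i _; rewrite fct_sumE.
by rewrite linear_mx_entry; do 2![apply: is_derive_sum => ?]; exact: is_deriveZ.
Qed.

Lemma continuous_linear_mx (R : realType) m n p q (A : set R)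
    (f : {linear 'M[R]_(m, n) -> 'M[R]_(p, q)}) (X : R -> 'M[R]_(m, n)) :
  {within A, continuous X} -> {within A, continuous (fun s => f (X s))}.
Proof.
move=> /continuous_entries cX; apply/continuous_entries => k l.
rewrite (_ : (fun s => _) = \sum_i \sum_j
    (fun s => f (delta_mx i j) k l * X s i j)); last first.
  apply/funext => s; rewrite linear_mx_entry fct_sumE.
  by apply: eq_bigr => i _; rewrite fct_sumE.
have cS N (h : 'I_N -> R -> R) :
    (forall k, {within A, continuous (h k)}) ->
    {within A, continuous (\sum_k h k)}.
  move=> ch.
  apply: (big_ind (fun g : R -> R => {within A, continuous g})) => //.
  - by move=> r; exact: cvg_cst.
  - by move=> g g' cg cg' r; exact: (cvgD (cg r) (cg' r)).
apply: (cS _ _) => i; apply: (cS _ _) => j r.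
by apply: cvgM; [exact: cvg_cst|exact: (cX i j r)].
Qed.

(** The weight [eps ^+ 2] makes the coupling created by a square-zero [N] small:
it acts like a change of basis that shrinks [N] to size [eps], but needs no
normal form of [N]. *)
Definition skewed_energy (R : realType) n (eps : R) (N : 'M[R]_n)
    (x : 'cV[R]_n) : R :=
  \sum_i (eps ^+ 2 * x i 0 ^+ 2 + (N *m x) i 0 ^+ 2).

(** The derivative of [skewed_energy eps N] at [x] in the direction [v]. *)
Definition skewed_power (R : realType) n (eps : R) (N : 'M[R]_n)
    (x v : 'cV[R]_n) : R :=
  2 * \sum_i (eps ^+ 2 * (x i 0 * v i 0) + (N *m x) i 0 * (N *m v) i 0).

Section skewed_energy.
Context (R : realType) (n : nat) (eps : R) (N : 'M[R]_n).
Hypothesis eps0 : 0 < eps.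
Let Q := skewed_energy eps N.

Lemma skewed_energy_ge0 x : 0 <= Q x.
Proof.
by apply: sumr_ge0 => i _; rewrite addr_ge0 ?sqr_ge0// mulr_ge0 ?sqr_ge0.
Qed.

Lemma norm_le_skewed_energy x : eps ^+ 2 * `|x| ^+ 2 <= Q x.
Proof.
have e2 : 0 < eps ^+ 2 by rewrite exprn_gt0.
rewrite mulrC -ler_pdivlMr//.
have q0 : 0 <= Q x / eps ^+ 2.
  by apply: divr_ge0; [exact: skewed_energy_ge0|exact: ltW].
rewrite -(sqr_sqrtr q0) ler_sqr ?nnegrE ?sqrtr_ge0//.
apply: norm_mx_le => [|i j]; first exact: sqrtr_ge0.
rewrite ord1 -sqrtr_sqr ler_wsqrtr// ler_pdivlMr// mulrC /Q /skewed_energy.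
rewrite (bigD1 i)//= -addrA lerDl addr_ge0 ?sqr_ge0//.
by apply: sumr_ge0 => k _; rewrite addr_ge0 ?sqr_ge0// mulr_ge0 ?sqr_ge0.
Qed.

Lemma skewed_energy_le_norm x :
  Q x <= n%:R * (eps ^+ 2 + (n%:R * `|N|) ^+ 2) * `|x| ^+ 2.
Proof.
rewrite -mulrA mulr_natl -[X in _ *+ X]card_ord -sumr_const ler_sum// => i _.
rewrite mulrDl lerD//.
  rewrite ler_wpM2l ?sqr_ge0// -[leLHS]real_normK ?num_real//.
  by rewrite ler_sqr ?nnegrE// entry_le_norm.
rewrite -exprMn -[leLHS]real_normK ?num_real// ler_sqr ?nnegrE ?mulr_ge0//.
by rewrite (le_trans (entry_le_norm _ _ _))// norm_mulmx_le.
Qed.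

Lemma is_derive_skewed_energy (x : R -> 'cV[R]_n) (t : R) v :
  is_derive t 1 x v ->
  is_derive t 1 (fun s => Q (x s)) (skewed_power eps N (x t) v).
Proof.
move=> dx; have /is_derive_entries dNx := is_derive_linear_mx (mulmx N) dx.
move/is_derive_entries : dx => dx.
rewrite (_ : (fun s => _) = \sum_i (fun s => eps ^+ 2 * x s i 0 ^+ 2 +
    (N *m x s) i 0 ^+ 2)); last by apply/funext => s; rewrite fct_sumE.
rewrite /skewed_power mulr_sumr; apply: is_derive_sum => i.
have := dx i 0; have := dNx i 0 => dNi di.
apply: is_derive_eq.
rewrite /GRing.scale/=; ring.
Qed.

Lemma continuous_skewed_energy (A : set R) (x : R -> 'cV[R]_n) :
  {within A, continuous x} -> {within A, continuous (fun s => Q (x s))}.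
Proof.
move=> cx; have /continuous_entries cNx := continuous_linear_mx (f:=mulmx N) cx.
move/continuous_entries : cx => cx.
rewrite (_ : (fun s => _) = \sum_i (fun s => eps ^+ 2 * (x s i 0 * x s i 0) +
    (N *m x s) i 0 * (N *m x s) i 0)); last first.
  by apply/funext => s; rewrite fct_sumE.
elim/big_ind : _ => [r|f g cf cg r|k _ r]; first exact: cvg_cst.
  exact: (cvgD (cf r) (cg r)).
apply: cvgD.
  by apply: cvgM; [exact: cvg_cst|exact: (cvgM (cx k 0 r) (cx k 0 r))].
exact: (cvgM (cNx k 0 r) (cNx k 0 r)).
Qed.

Hypothesis NN0 : N *m N = 0.

(** A perturbation [E] of the matrix of the system changes the power by at most
[2 n^2 (eps^2 + (n |N|)^2) |E| |x|^2], and [|x|^2 <= Q x / eps^2]. *)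
Definition power_cst : R :=
  n%:R * (2 * n%:R * (eps ^+ 2 + (n%:R * `|N|) ^+ 2)) / eps ^+ 2.

Lemma power_cst_ge0 : 0 <= power_cst.
Proof.
apply: divr_ge0; last exact: sqr_ge0.
by do 2![apply: mulr_ge0 => //]; apply: addr_ge0; exact: sqr_ge0.
Qed.

(** Expanding [A x = mu x + N x + E x] and [N A x = mu N x + N E x], where
[N N = 0] is used, the terms in [mu] cancel against [2 mu Q x]. The term
[2 eps^2 x_i (N x)_i] is at most [eps (eps^2 x_i^2 + (N x)_i^2)], because
[(eps x_i - (N x)_i)^2 >= 0], and all remaining terms contain [E]. *)
Lemma skewed_power_bound (A : 'M[R]_n) (mu eta : R) x :
  `|A - mu%:M - N| <= eta ->
  `|skewed_power eps N x (A *m x) - 2 * mu * Q x|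
    <= (eps + power_cst * eta) * Q x.
Proof.
set E := A - _ - N => Eeta.
have eta0 : 0 <= eta by rewrite (le_trans _ Eeta).
have AE : A *m x = mu *: x + N *m x + E *m x.
  rewrite /E !mulmxBl mul_scalar_mx.
  by apply/matrixP => i j; rewrite !mxE; ring.
have NAE : N *m (A *m x) = mu *: (N *m x) + N *m (E *m x).
  by rewrite AE !mulmxDr mulmxA NN0 mul0mx addr0 -scalemxAr.
set nu := n%:R * `|N|.
have nu0 : 0 <= nu by rewrite mulr_ge0.
have Ex : `|E *m x| <= n%:R * eta * `|x|.
  rewrite (le_trans (norm_mulmx_le _ _))// ler_wpM2r// ler_wpM2l//.
have NEx : `|N *m (E *m x)| <= nu * (n%:R * eta * `|x|).
  by rewrite (le_trans (norm_mulmx_le _ _))// ler_wpM2l.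
have Nx : `|N *m x| <= nu * `|x| by exact: norm_mulmx_le.
pose T := 2 * n%:R * (eps ^+ 2 + nu ^+ 2) * eta * `|x| ^+ 2.
have le1 : `|skewed_power eps N x (A *m x) - 2 * mu * Q x|
    <= eps * Q x + n%:R * T.
  rewrite /skewed_power /Q /skewed_energy NAE AE -mulrA -mulrBr !mulr_sumr.
  rewrite -sumrB mulr_sumr.
  rewrite (le_trans (ler_norm_sum _ _ _))//.
  rewrite (_ : n%:R * T = \sum_(i < n) T); last first.
    by rewrite sumr_const card_ord mulr_natl.
  rewrite -big_split/= ler_sum// => i _.
  have := le_trans (entry_le_norm (E *m x) i 0) Ex.
  have := le_trans (entry_le_norm (N *m (E *m x)) i 0) NEx.
  have := le_trans (entry_le_norm (N *m x) i 0) Nx.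
  have := entry_le_norm x i 0.
  have addE (u v : 'cV[R]_n) : (u + v) i 0 = u i 0 + v i 0 by rewrite mxE.
  have scaleE (u : 'cV[R]_n) : (mu *: u) i 0 = mu * u i 0 by rewrite mxE.
  rewrite !addE !scaleE.
  move: (x i 0) ((N *m x) i 0) ((E *m x) i 0) ((N *m (E *m x)) i 0).
  move=> a b e f ha hb he hf.
  rewrite (_ : 2 * _ = 2 * eps ^+ 2 * a * b + 2 * eps ^+ 2 * (a * e)
      + 2 * (b * f)); last by ring.
  rewrite (le_trans (ler_normD _ _))//.
  rewrite (le_trans (lerD (ler_normD _ _) (lexx _)))// -addrA lerD//.
    rewrite ler_norml; apply/andP; split; rewrite -subr_ge0.
      rewrite (_ : _ - _ = eps * (eps * a + b) ^+ 2); last by ring.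
      by rewrite mulr_ge0 ?sqr_ge0 ?ltW.
    rewrite (_ : _ - _ = eps * (eps * a - b) ^+ 2); last by ring.
    by rewrite mulr_ge0 ?sqr_ge0 ?ltW.
  have -> : T = 2 * eps ^+ 2 * (`|x| * (n%:R * eta * `|x|)) +
      2 * (nu * `|x| * (nu * (n%:R * eta * `|x|))) by rewrite /T; ring.
  rewrite (normrM (2 * eps ^+ 2) (a * e)) (normrM a e).
  rewrite (normrM 2 (b * f)) (normrM b f) [`|2 * _|]ger0_norm; last first.
    by rewrite mulr_ge0 ?sqr_ge0.
  rewrite [`|2|]ger0_norm//.
  apply: lerD; last by rewrite ler_wpM2l// ler_pM.
  by rewrite ler_wpM2l ?ler_pM// mulr_ge0 ?sqr_ge0.
apply: (le_trans le1); rewrite mulrDl lerD2l.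
have e2 : eps ^+ 2 != 0 by rewrite expf_neq0// gt_eqF.
rewrite (_ : n%:R * T = power_cst * eta * (eps ^+ 2 * `|x| ^+ 2)); last first.
  by rewrite /T /power_cst -/nu; field; rewrite gt_eqF.
by rewrite ler_wpM2l ?norm_le_skewed_energy// mulr_ge0 ?power_cst_ge0.
Qed.

End skewed_energy.

(** The relative rate of change of [skewed_energy eps N] along a solution lies
within [eps + C exp(lambda t)] of [2 mu], and [C exp(lambda t)] has a finite
integral over the half-line. *)
Lemma bohl_exponent_of_limit (R : realType) n (M : R -> 'M[R]_n)
    (N : 'M[R]_n) (mu lambda c : R) :
  lambda < 0 -> N *m N = 0 ->
  (forall t : R, 0 <= t -> `|M t - mu%:M - N| <= c * expR (lambda * t)) ->
  bohl_exponent M mu.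
Proof.
move=> la0 NN0 MN eps eps0.
have c0 : 0 <= c.
  by have := MN 0 (lexx _); rewrite mulr0 expR0 mulr1; apply: le_trans.
pose Q := skewed_energy eps N; pose C := power_cst eps N * c.
have C0 : 0 <= C.
  by rewrite mulr_ge0 ?power_cst_ge0.
have Cl : C / lambda <= 0 by rewrite mulr_ge0_le0// invr_le0 ltW.
(* Primitives of the upper (s = 1) and lower (s = -1) bounds on the relative
   rate of change of the energy. *)
pose h (s t : R) : R :=
  (2 * mu + s * eps) * t + s * (C / lambda) * expR (lambda * t).
pose k (s t : R) : R := 2 * mu + s * (eps + C * expR (lambda * t)).
have dh s (t : R) : is_derive t 1 (h s) (k s t).
  have de := is_derive_expRM lambda t.
  rewrite (_ : h s = (2 * mu + s * eps) *: id +
      (s * (C / lambda)) *: (fun s => expR (lambda * s)))//.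
  apply: is_derive_eq; rewrite /k /GRing.scale/=; field.
  by rewrite lt_eqF.
have ch s : {within `[0, +oo[, continuous (h s)}.
  apply: continuous_subspaceT => t.
  exact: is_derive_continuous (dh s t).
have hB s a b : 0 <= a -> a <= b -> `|s| = 1 ->
    `|h s b - h s a - (2 * mu + s * eps) * (b - a)| <= - (C / lambda).
  move=> a0 ab s1.
  rewrite (_ : _ - _ = s * (C / lambda *
      (expR (lambda * b) - expR (lambda * a)))); last first.
    by rewrite /h; ring.
  rewrite normrM s1 mul1r normrM.
  rewrite ler0_norm//.
  rewrite -[leRHS]mulr1 ler_wpM2l//.
    by rewrite oppr_ge0.
  have b1 : expR (lambda * b) <= expR (lambda * a).
    by rewrite ler_expR ler_nM2l.
  have a1 : expR (lambda * a) <= 1.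
    by rewrite -expR0 ler_expR mulr_le0_ge0// ltW.
  rewrite ler0_norm ?subr_le0// opprB.
  by have := expR_ge0 (lambda * b); lra.
pose D := - (C / lambda).
have main (x : R -> 'cV[R]_n) : linear_solution M x ->
    forall s t : R, 0 <= s -> 0 <= t ->
    Q (x t) <= Q (x s) * expR (2 * mu * (t - s) + eps * `|t - s| + D).
  move=> [cx dx] s t s0 t0.
  have bd (r : R) : 0 < r -> `|skewed_power eps N (x r) (M r *m x r)
      - 2 * mu * Q (x r)| <= (eps + C * expR (lambda * r)) * Q (x r).
    move=> r0; rewrite /C -[_ * c * _]mulrA.
    by apply: skewed_power_bound => //; apply: MN; exact: ltW.
  have dQ (r : R) : 0 < r -> is_derive r 1 (fun r => Q (x r))
      (skewed_power eps N (x r) (M r *m x r)).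
    by move=> r0; apply: is_derive_skewed_energy; exact: dx.
  have cQ := continuous_skewed_energy (eps:=eps) (N:=N) cx.
  have [st|/ltW ts] := leP s t.
    have up (r : R) : 0 < r ->
        skewed_power eps N (x r) (M r *m x r) <= k 1 r * Q (x r).
      move=> /bd; rewrite ler_norml => /andP[_].
      by rewrite lerBlDl -mulrDl /k mul1r.
    have H := gronwall_upper cQ (ch 1) dQ (fun r _ => dh 1 r) up s0 st.
    apply: (le_trans H).
    rewrite ler_wpM2l ?skewed_energy_ge0// ler_expR ger0_norm ?subr_ge0//.
    have := hB 1 s t s0 st (normr1 _); rewrite ler_norml => /andP[_].
    by rewrite /D; lra.
  have lo (r : R) : 0 < r ->
      k (-1) r * Q (x r) <= skewed_power eps N (x r) (M r *m x r).
    move=> /bd; rewrite ler_norml => /andP[+ _].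
    by rewrite lerBrDl -mulNr -mulrDl /k mulN1r.
  have := gronwall_lower cQ (ch (-1)) dQ (fun r _ => dh (-1) r) lo t0 ts.
  rewrite -ler_pdivlMr ?expR_gt0// -expRN => H; apply: (le_trans H).
  rewrite ler_wpM2l ?skewed_energy_ge0// ler_expR ler0_norm ?subr_le0//.
  have := hB (-1) t s t0 ts; rewrite normrN1 => /(_ erefl).
  rewrite ler_norml => /andP[+ _].
  by rewrite /D; lra.
pose B : R := n%:R * (eps ^+ 2 + (n%:R * `|N|) ^+ 2).
have B0 : 0 <= B by apply: mulr_ge0 => //; apply: addr_ge0; exact: sqr_ge0.
have e2 : 0 < eps ^+ 2 by rewrite exprn_gt0.
pose K0 := B * expR D / eps ^+ 2.
have K00 : 0 <= K0.
  by apply: divr_ge0; [exact: mulr_ge0 (expR_ge0 _)|exact: ltW].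
exists (1 + K0); first by rewrite lerDl.
move=> x solx s t s0 t0.
rewrite -ler_sqr ?nnegrE ?mulr_ge0 ?expR_ge0 ?addr_ge0//.
rewrite -(ler_pM2l e2); apply: (le_trans (norm_le_skewed_energy N eps0 _)).
apply: (le_trans (main x solx s t s0 t0)).
apply: (@le_trans _ _ (B * `|x s| ^+ 2 *
    expR (2 * mu * (t - s) + eps * `|t - s| + D))).
  by rewrite ler_wpM2r ?expR_ge0// skewed_energy_le_norm.
rewrite expRD !exprMn -expRM_natl.
rewrite (_ : _ * _ = eps ^+ 2 * (K0 * expR (2 * mu * (t - s) + eps * `|t - s|)
    * `|x s| ^+ 2)); last by rewrite /K0; field; rewrite gt_eqF.
rewrite ler_wpM2l ?(ltW e2)// ler_wpM2r ?sqr_ge0// ler_pM ?expR_ge0//.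
  by rewrite expr2; nra.
by rewrite ler_expR; have := normr_ge0 (t - s); nra.
Qed.

(** * Existence of solutions *)

Section primitive.
Context (R : realType).
Notation mu := (@lebesgue_measure R).

Lemma continuous_integrable_itv (a b : R) (f : R -> R) :
  continuous f -> mu.-integrable `[a, b] (EFin \o f).
Proof.
move=> cf; apply: continuous_compact_integrable; first exact: segment_compact.
exact: continuous_subspaceT.
Qed.

(** Continuity on the whole line, including at 0 and at negative arguments:
there the domain of integration is empty and the integral vanishes. Hence
primitives can be handled without restricting them to a half-line. *)
Lemma continuous_primitive (f : R -> R) :
  (forall T : R, mu.-integrable `[0, T] (EFin \o f)) ->
  continuous (fun t : R => \int[mu]_(r in `[0, t]) f r).
Proof.
move=> intf t; pose b := 1 + `|t|.
have b0 : 0 < b by rewrite ltr_pwDl.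
have tb : t \in `]- b, b[.
  by rewrite in_itv/= -ltr_norml ltrDr.
(* Cutting [f] off at 0 turns this into a primitive based at [-b], for which
   [t] is an interior point. *)
have restr (x : R) : `[0, x]%classic = `[- b, x]%classic `&` `[0, +oo[%classic.
  apply/seteqP; split => r/=; rewrite !in_itv/= andbT.
    move=> /andP[r0 rx]; split => //.
    by rewrite rx (le_trans _ r0)// oppr_le0 ltW.
  by move=> [/andP[_ ->] ->].
have E : (fun x : R => \int[mu]_(r in `[0, x]) f r) =
    (fun x : R => \int[mu]_(r in `[- b, x]) (f \_ `[0, +oo[%classic) r).
  by apply/funext => x; rewrite restr Rintegral_mkcondr.
rewrite E; apply: within_continuous_continuous tb.
  by rewrite gtrN.
apply: parameterized_integral_continuous; first by rewrite ltW// gtrN.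
rewrite -restrict_EFin; apply/integrable_restrict => //.
by rewrite -restr.
Qed.

Lemma is_derive_primitive (f : R -> R) (t : R) : continuous f -> 0 < t ->
  is_derive t 1 (fun t : R => \int[mu]_(r in `[0, t]) f r) (f t).
Proof.
move=> cf t0.
have tu : t < t + 1 by rewrite ltrDl.
have [df fE] := continuous_FTC1_closed tu
  (continuous_integrable_itv _ _ cf) t0 (cf t).
by split => //; rewrite -derive1E.
Qed.

(** In the norm weighted by [exp(L r)], integration contracts by the factor
[1 / L]. *)
Lemma norm_primitive_le_exp (f : R -> R) (A L t : R) :
  0 < L -> 0 <= A -> 0 <= t -> mu.-integrable `[0, t] (EFin \o f) ->
  (forall r : R, 0 <= r -> `|f r| <= A * expR (L * r)) ->
  `|\int[mu]_(r in `[0, t]) f r| <= A / L * expR (L * t).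
Proof.
move=> L0 A0; rewrite le_eqVlt => /predU1P[<- _ _|t0 intf fA].
  rewrite set_itv1 Rintegral_set1 normr0 mulr_ge0 ?expR_ge0//.
  by rewrite divr_ge0 // ltW.
have ce : continuous (fun r : R => A * expR (L * r)).
  by move=> r; apply: cvgM; [exact: cvg_cst|exact: continuous_expRM].
have ie := continuous_integrable_itv 0 t ce.
apply: (le_trans (le_normr_Rintegral _ intf)) => //.
apply: (@le_trans _ _ (\int[mu]_(r in `[0, t]) (A * expR (L * r)))).
  apply: le_Rintegral => //; first exact: integrable_norm.
  by move=> r; rewrite /= in_itv/= => /andP[r0 _]; exact: fA.
pose G r := A / L * expR (L * r).
have dG (r : R) : is_derive r 1 G (A * expR (L * r)).
  have de := is_derive_expRM L r.
  rewrite (_ : G = (A / L) *: (fun s => expR (L * s)))//; apply: is_derive_eq.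
  by rewrite /GRing.scale/=; field; rewrite gt_eqF.
have cG : continuous G.
  by move=> r; apply: is_derive_continuous (dG r).
rewrite /Rintegral (@continuous_FTC2 _ _ G)//=.
- by rewrite lerBlDr lerDl /G mulr_ge0 ?expR_ge0// divr_ge0// ltW.
- exact: continuous_subspaceT.
- split; first by move=> r _; have [] := dG r.
    by apply: cvg_at_right_filter; exact: cG.
  by apply: cvg_at_left_filter; exact: cG.
- by move=> r _; rewrite derive1E; have [_ ->] := dG r.
Qed.

Lemma integrable_entry m q (F : R -> 'M[R]_(m, q)) (a b : R) i j :
  continuous F -> mu.-integrable `[a, b] (fun r => (F r i j)%:E).
Proof.
move=> cF; apply: (@continuous_integrable_itv _ _ (fun r => F r i j)) => r.
by have /cvg_entries cFr := cF r; exact: cFr.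
Qed.

Definition mx_primitive m n (F : R -> 'M[R]_(m, n)) (t : R) : 'M[R]_(m, n) :=
  \matrix_(i, j) \int[mu]_(r in `[0, t]) F r i j.

Lemma continuous_mx_primitive m n (F : R -> 'M[R]_(m, n)) :
  (forall T i j, mu.-integrable `[0, T] (fun r => (F r i j)%:E)) ->
  continuous (mx_primitive F).
Proof.
move=> intF t; apply/cvg_entries => i j; rewrite mxE.
rewrite (_ : (fun s => _) = fun s : R => \int[mu]_(r in `[0, s]) F r i j).
  have := @continuous_primitive (fun r => F r i j) _ t; apply => T; exact: intF.
by apply/funext => s; rewrite mxE.
Qed.

Lemma is_derive_mx_primitive m n (F : R -> 'M[R]_(m, n)) (t : R) :
  continuous F -> 0 < t -> is_derive t 1 (mx_primitive F) (F t).
Proof.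
move=> cF t0; apply/is_derive_entries => i j.
rewrite (_ : (fun s => _) = fun s : R => \int[mu]_(r in `[0, s]) F r i j).
  apply: (@is_derive_primitive (fun r => F r i j)) => // r.
  by have /cvg_entries cFr := cF r; exact: cFr.
by apply/funext => s; rewrite mxE.
Qed.

Lemma mx_primitive0 m n (F : R -> 'M[R]_(m, n)) : mx_primitive F 0 = 0.
Proof. by apply/matrixP => i j; rewrite !mxE set_itv1 Rintegral_set1. Qed.

Lemma eq_mx_primitive m n (F G : R -> 'M[R]_(m, n)) t :
  (forall r : R, 0 <= r -> F r = G r) -> mx_primitive F t = mx_primitive G t.
Proof.
move=> FG; apply/matrixP => i j; rewrite !mxE; apply: eq_Rintegral => r.
by rewrite inE/= in_itv/= => /andP[r0 _]; rewrite FG.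
Qed.

Lemma continuous_mulmx m n p (M : R -> 'M[R]_(m, n)) (X : R -> 'M[R]_(n, p)) :
  continuous M -> continuous X -> continuous (fun t => M t *m X t).
Proof.
move=> cM cX t; apply/cvg_entries => i j.
rewrite (_ : (fun s => _) = \sum_k (fun s => M s i k * X s k j)); last first.
  by apply/funext => s; rewrite mxE fct_sumE.
rewrite mxE; elim/big_ind2 : _ => [|f a g b fa gb|k _]; first exact: cvg_cst.
  exact: (cvgD fa gb).
apply: cvgM.
  by have /cvg_entries cMt := cM t; exact: cMt.
by have /cvg_entries cXt := cX t; exact: cXt.
Qed.

(** Bootstrap: the right-hand side of the integral equation is continuous, so
[X] agrees on the half-line with a continuous [Y]; then the integrand [M Y] is
continuous and the right-hand side is differentiable. *)
Lemma linear_solution_of_integral n p (M : R -> 'M[R]_n) (X : R -> 'M[R]_(n, p))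
    (V : 'M[R]_(n, p)) :
  continuous M ->
  (forall T i j, mu.-integrable `[0, T] (fun r => ((M r *m X r) i j)%:E)) ->
  (forall t : R, 0 <= t -> X t = V + mx_primitive (fun r => M r *m X r) t) ->
  linear_solution M X.
Proof.
move=> cM intMX XE; pose Y t := V + mx_primitive (fun r => M r *m X r) t.
have cY : continuous Y.
  move=> t; apply: cvgD; first exact: cvg_cst.
  exact: continuous_mx_primitive.
have YE t : Y t = V + mx_primitive (fun r => M r *m Y r) t.
  by congr (_ + _); apply: eq_mx_primitive => r r0; rewrite (XE r r0).
split.
  apply: (@subspace_eq_continuous _ _ _ Y).
    by move=> t; rewrite inE/= in_itv/= andbT => t0; exact/esym/XE.
  exact: continuous_subspaceT.
move=> t t0; apply: (@near_eq_is_derive _ _ _ Y).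
  near=> s; rewrite (XE s)//.
  by near: s; apply: filterS (lt_nbhsr t0) => s /ltW.
rewrite (XE t (ltW t0)) -/(Y t).
have dP := is_derive_mx_primitive (continuous_mulmx cM cY) t0.
move: (M t *m Y t) dP => D dP.
rewrite (_ : Y = cst V + mx_primitive (fun r => M r *m Y r)).
  by rewrite -[D]add0r; apply: is_deriveD.
by apply/funext => s; exact: YE.
Unshelve. all: by end_near. Qed.

End primitive.

(** Picard iteration. In the norm weighted by [exp(L t)], with [L] large
compared with the bound [c] on [M], each step is a contraction of ratio 1/2 on
the whole half-line, so that the iterates converge pointwise, dominated by a
fixed exponential. Dominated convergence passes to the limit in the integral
equation, without uniform convergence. *)
Section picard.
Context (R : realType) (n p : nat) (M : R -> 'M[R]_n) (V : 'M[R]_(n, p)).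
Context (c : R).
Hypothesis cM : continuous M.
Hypothesis Mc : forall t : R, 0 <= t -> `|M t| <= c.
Notation mu := (@lebesgue_measure R).

Fixpoint picard (k : nat) : R -> 'M[R]_(n, p) :=
  if k is k'.+1 then fun t => V + mx_primitive (fun r => M r *m picard k' r) t
  else fun=> V.

Lemma continuous_picard k : continuous (picard k).
Proof.
elim: k => [|k ih] t; first exact: cvg_cst.
apply: cvgD; first exact: cvg_cst.
apply: continuous_mx_primitive => T i j; apply: integrable_entry.
exact: continuous_mulmx.
Qed.

(* The summand 1 keeps [L] positive when [n] or [c] vanishes. *)
Let L : R := 2 * (n%:R * c + 1).

Let nc0 : 0 <= n%:R * c.
Proof. by rewrite mulr_ge0// (le_trans _ (Mc (lexx _))). Qed.

Let L0 : 0 < L.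
Proof. by rewrite mulr_gt0// ltr_wpDl. Qed.

Let contraction (F : R -> 'M[R]_(n, p)) (D t : R) :
  (forall r : R, 0 <= r -> `|F r| <= D * expR (L * r)) -> 0 <= D ->
  continuous F -> 0 <= t ->
  `|mx_primitive (fun r => M r *m F r) t| <= D / 2 * expR (L * t).
Proof.
move=> FD D0 cF t0; apply: norm_mx_le => [|i j].
  by rewrite mulr_ge0 ?expR_ge0// divr_ge0.
rewrite mxE.
apply: (@le_trans _ _ (n%:R * c * D / L * expR (L * t))).
  apply: (@norm_primitive_le_exp _ (fun r => (M r *m F r) i j)) => //.
  - exact: mulr_ge0.
  - apply: (@integrable_entry _ _ _ (fun r => M r *m F r)).
    exact: continuous_mulmx.
  - move=> r r0; apply: (le_trans (entry_le_norm _ _ _)).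
    apply: (le_trans (norm_mulmx_le _ _)).
    rewrite -[leRHS]mulrA; apply: ler_pM; rewrite ?mulr_ge0//; last exact: FD.
    by rewrite ler_wpM2l// Mc.
rewrite ler_wpM2r ?expR_ge0// ler_pdivrMr// /L.
by have := nc0; nra.
Qed.

Let picard_le k (t : R) : 0 <= t -> `|picard k t| <= 2 * `|V| * expR (L * t).
Proof.
elim: k t => [|k ih] t t0.
  have : 1 <= expR (L * t) by rewrite -expR0 ler_expR mulr_ge0// ltW.
  by have := normr_ge0 V => /=; nra.
have e1 : 1 <= expR (L * t) by rewrite -expR0 ler_expR mulr_ge0// ltW.
have := contraction ih; have := normr_ge0 V => V0 /(_ t).
rewrite mulr_ge0// => /(_ isT (@continuous_picard k) t0) H.
rewrite /= (le_trans (ler_normD _ _))// (le_trans (lerD (lexx _) H))//.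
by nra.
Qed.

Let picard_step k (t : R) : 0 <= t ->
  `|picard k.+1 t - picard k t| <= `|V| * 2^-1 ^+ k * expR (L * t).
Proof.
elim: k t => [|k ih] t t0.
  rewrite /= addrC addKr expr0 mulr1.
  have e1 (r : R) : 0 <= r -> `|V| <= `|V| * expR (L * r).
    by move=> r0; rewrite ler_peMr// -expR0 ler_expR mulr_ge0// ltW.
  have := contraction e1 (normr_ge0 _) (@continuous_picard 0) t0.
  move=> /le_trans; apply; rewrite ler_wpM2r ?expR_ge0//.
  by have := normr_ge0 V; lra.
have -> : picard k.+2 t - picard k.+1 t =
    mx_primitive (fun r => M r *m (picard k.+1 r - picard k r)) t.
  rewrite [picard k.+2]/= [picard k.+1 in X in _ - X]/=.
  rewrite opprD addrACA subrr add0r.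
  apply/matrixP => i j; rewrite !mxE -RintegralB//; last 2 first.
  - apply: (@integrable_entry _ _ _ (fun r => M r *m picard k.+1 r)).
    by apply: continuous_mulmx => //; exact: continuous_picard.
  - apply: (@integrable_entry _ _ _ (fun r => M r *m picard k r)).
    by apply: continuous_mulmx => //; exact: continuous_picard.
  by apply: eq_Rintegral => r _; rewrite mulmxBr !mxE.
rewrite exprSr mulrA; apply: (contraction ih) t0.
  by rewrite mulr_ge0// exprn_ge0.
by move=> r; apply: cvgB; exact: continuous_picard.
Qed.

Let picard_cvg (t : R) i j : 0 <= t -> cvgn (fun k => picard k t i j).
Proof.
move=> t0; pose u k := picard k t i j.
have cu : cvgn (series (telescope u)).
  apply: normed_cvg; pose D := `|V| * expR (L * t).
  apply: (@series_le_cvg _ _ (geometric D (2^-1))) => //= [k|k|].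
  - by rewrite !mulr_ge0 ?expR_ge0 ?exprn_ge0.
  - have := picard_step k t0; rewrite mulrAC; apply: le_trans.
    have := entry_le_norm (picard k.+1 t - picard k t) i j.
    have subE (A B : 'M[R]_(n, p)) : (A - B) i j = A i j - B i j.
      by rewrite !mxE.
    by rewrite subE.
  - by apply: is_cvg_geometric_series; rewrite ger0_norm// invf_lt1// ltr1n.
rewrite (_ : (fun k => _) = (fun k => u 0%N + series (telescope u) k)).
  by apply: is_cvgD => //; exact: is_cvg_cst.
by apply/funext => k; rewrite -eq_sum_telescope.
Qed.

Lemma linear_solution_exists :
  exists X : R -> 'M[R]_(n, p), linear_solution M X /\ X 0 = V.
Proof.
pose X (t : R) : 'M[R]_(n, p) := \matrix_(i, j) limn (fun k => picard k t i j).
have XE (t : R) i j : 0 <= t -> (fun k => picard k t i j) @ \oo --> X t i j.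
  by move=> t0; rewrite mxE; exact: picard_cvg.
pose f k i j (r : R) := (M r *m picard k r) i j.
have fX (r : R) i j : 0 <= r -> (fun k => f k i j r) @ \oo --> (M r *m X r) i j.
  move=> r0; rewrite mxE.
  rewrite (_ : (fun k => _) =
      \sum_l (fun k => M r i l * picard k r l j)); last first.
    by apply/funext => k; rewrite /f mxE fct_sumE.
  elim/big_ind2 : _ => [|u a v b ua vb|l _]; first exact: cvg_cst.
    exact: (cvgD ua vb).
  by apply: cvgM; [exact: cvg_cst|exact: XE].
have cf k i j : continuous (f k i j).
  move=> r; have := continuous_mulmx cM (@continuous_picard k).
  by move=> /(_ r)/cvg_entries; apply.
have dct (T : R) i j :
    mu.-integrable `[0, T] (fun r => ((M r *m X r) i j)%:E) /\
    (fun k => \int[mu]_(r in `[0, T]) f k i j r) @ \oo -->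
      \int[mu]_(r in `[0, T]) (M r *m X r) i j.
  pose B := n%:R * c * (2 * `|V| * expR (L * T)).
  have [||||||] := @dominated_convergence _ _ _ mu `[0, T] _
    (fun k r => (f k i j r)%:E) (fun r => ((M r *m X r) i j)%:E)
    (cst B%:E) => //.
  - move=> k; apply/measurable_EFinP; apply: measurable_funTS.
    exact: continuous_measurable_fun.
  - apply/measurable_EFinP; apply: (measurable_fun_cvg (h := fun k => f k i j)).
      by move=> k; apply: measurable_funTS; exact: continuous_measurable_fun.
    by move=> r; rewrite /= in_itv/= => /andP[r0 _]; exact: fX.
  - apply: aeW => r; rewrite /= in_itv/= => /andP[r0 _].
    by apply: cvg_EFin; [exact: nearW|exact: fX].
  - exact: (@continuous_integrable_itv _ _ _ (cst B) (@cst_continuous _ _ B)).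
  - apply: aeW => r k; rewrite /= in_itv/= => /andP[r0 rT]; rewrite lee_fin.
    apply: (le_trans (entry_le_norm _ _ _)).
    apply: (le_trans (norm_mulmx_le _ _)).
    apply: ler_pM; rewrite ?mulr_ge0//; first by rewrite ler_wpM2l// Mc.
    apply: (le_trans (picard_le k r0)); rewrite ler_wpM2l ?mulr_ge0//.
    by rewrite ler_expR ler_wpM2l// ltW.
  move=> iX _ cX; split => //; apply: fine_cvg.
  rewrite /Rintegral fineK//; exact: integrable_fin_num.
exists X; split; last first.
  apply/matrixP => i j; rewrite mxE.
  rewrite (_ : (fun k => _) = cst (V i j)); first exact: lim_cst.
  by apply/funext => -[|k] //=; rewrite mx_primitive0 addr0.
apply: (linear_solution_of_integral (V := V)) => //.
  by move=> T i j; have [] := dct T i j.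
move=> t t0; apply/matrixP => i j; rewrite [RHS]mxE [X in _ + X]mxE.
have [_ cI] := dct t i j.
have XS : (fun k => picard k.+1 t i j) @ \oo --> X t i j.
  by have := XE t i j t0; rewrite -(cvg_shiftS (fun k => picard k t i j)).
have SE : (fun k => picard k.+1 t i j) =
    (fun k => V i j + \int[mu]_(r in `[0, t]) f k i j r).
  by apply/funext => k; rewrite /= !mxE.
rewrite SE in XS; apply: (cvg_unique _ XS); first exact: Rhausdorff.
by apply: cvgD; [exact: cvg_cst|exact: cI].
Qed.

End picard.

(** * Exponential dichotomy from the Bohl exponent *)

Section linear_solutions.
Context (R : realType) (n : nat) (M : R -> 'M[R]_n).
Notation mu := (@lebesgue_measure R).
Notation Rplus := (`[0, +oo[%R : interval R).

Lemma linear_solution_mulmxr p q (X : R -> 'M[R]_(n, p)) (y : 'M[R]_(p, q)) :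
  linear_solution M X -> linear_solution M (fun t => X t *m y).
Proof.
move=> [cX dX]; split; first exact: (continuous_linear_mx (f := mulmxr y)).
move=> t t0; rewrite mulmxA.
exact: (is_derive_linear_mx (mulmxr y) (dX t t0)).
Qed.

(** A fundamental matrix is only assumed to solve an integral equation with
integrable coefficients; it is in fact a classical solution. *)
Lemma linear_solution_fundamental (Phi : R -> 'M[R]_n) :
  continuous M -> fundamental_matrix Rplus M Phi -> linear_solution M Phi.
Proof.
move=> cM [_ intMPhi PhiE].
apply: (linear_solution_of_integral (V := Phi 0)) => // [T i j|t t0].
  have [T0|T0] := leP 0 T.
    by apply: intMPhi; rewrite in_itv/= ?lexx ?T0.
  by rewrite set_itv_ge ?bnd_simp -?ltNge//; exact: integrable_set0.
apply/matrixP => i j; rewrite mxE [X in _ + X]mxE.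
by apply: PhiE; rewrite // in_itv/= ?lexx ?t0.
Qed.

Lemma fundamental_linear_solution (Phi : R -> 'M[R]_n) :
  continuous M -> linear_solution M Phi ->
  (forall t : R, 0 <= t -> Phi t \in unitmx) -> fundamental_matrix Rplus M Phi.
Proof.
move=> cM [cPhi dPhi] uPhi.
have cMP (s t : R) i j : 0 <= s ->
    {within `[s, t], continuous (fun r => (M r *m Phi r) i j)}.
  move=> s0.
  have cPhi' : {within `[s, t], continuous Phi}.
    apply: continuous_subspaceW cPhi => r/=; rewrite !in_itv/= andbT.
    by move=> /andP[+ _]; exact: le_trans.
  rewrite (_ : (fun r => _) =
      \sum_k (fun r => M r i k * Phi r k j)); last first.
    by apply/funext => r; rewrite mxE fct_sumE.
  move/continuous_entries : cPhi' => cPhi'.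
  apply: (big_ind (fun g : R -> R => {within `[s, t], continuous g})).
  - by move=> r; exact: cvg_cst.
  - by move=> f g cf cg r; exact: (cvgD (cf r) (cg r)).
  move=> k _ r; apply: cvgM; last exact: (cPhi' k j r).
  have : {within `[s, t], continuous (fun r => M r i k)}.
    apply: continuous_subspaceT => x; have /cvg_entries cMx := cM x.
    exact: cMx.
  by move=> /(_ r).
split.
- by move=> t; rewrite in_itv/= andbT; exact: uPhi.
- move=> s t; rewrite !in_itv/= !andbT => s0 _ i j.
  apply: (@continuous_compact_integrable _ (fun r => (M r *m Phi r) i j)).
    exact: segment_compact.
  exact: cMP.
move=> s t; rewrite !in_itv/= !andbT => s0 _.
rewrite le_eqVlt => /predU1P[<- i j|st i j].
  by rewrite set_itv1 Rintegral_set1 addr0.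
have dij (r : R) : r \in `]s, t[ ->
    is_derive r 1 (fun r => Phi r i j) ((M r *m Phi r) i j).
  rewrite in_itv/= => /andP[sr _].
  have /is_derive_entries := dPhi r (le_lt_trans s0 sr); exact.
have cPij : {within `[s, t], continuous (fun r => Phi r i j)}.
  move/continuous_entries : cPhi => /(_ i j); apply: continuous_subspaceW.
  move=> r/=; rewrite !in_itv/= andbT.
  by move=> /andP[+ _]; exact: le_trans.
have [_ cl cr] := (continuous_within_itvP _ st).1 cPij.
have dLR : derivable_oo_LRcontinuous (fun r => Phi r i j) s t.
  by split => // r rst; have [] := dij r rst.
have dE : {in `]s, t[, derive1 (fun r => Phi r i j) =1
    (fun r => (M r *m Phi r) i j)}.
  by move=> r rst; rewrite derive1E; have [_ ->] := dij r rst.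
have FTC := continuous_FTC2 st (cMP s t i j s0) dLR dE.
by rewrite /Rintegral FTC/=; ring.
Qed.

(** [exp(gamma r) x(r)] solves the unshifted system when [x] solves the shifted
one. *)
Lemma bohl_exponent_shift (m gamma : R) : bohl_exponent M m ->
  bohl_exponent (fun t => M t - gamma%:M) (m - gamma).
Proof.
move=> bM eps eps0; have [K K1 HK] := bM eps eps0; exists K => //.
move=> x [cx dx] s t s0 t0.
pose y (r : R) := expR (gamma * r) *: x r.
have soly : linear_solution M y.
  split.
    move/continuous_entries : cx => cx; apply/continuous_entries => i j.
    rewrite (_ : (fun r => _) = (fun r => expR (gamma * r) * x r i j)).
      have ce : {within `[0, +oo[, continuous (fun r => expR (gamma * r))}.
        by apply: continuous_subspaceT; exact: continuous_expRM.
      by move=> r; exact: (cvgM (ce r) (cx i j r)).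
    by apply/funext => r; rewrite mxE.
  move=> r r0; have /is_derive_entries dxr := dx r r0.
  apply/is_derive_entries => i j.
  rewrite (_ : (fun r => _) = (fun r => expR (gamma * r)) * (fun r => x r i j)).
    have := dxr i j; have := is_derive_expRM gamma r => de dij.
    apply: is_derive_eq; rewrite mulmxBl mul_scalar_mx /y -scalemxAr.
    rewrite [(_ *: (_ *m _)) i j]mxE.
    have -> : (M r *m x r - gamma *: x r) i j =
        (M r *m x r) i j - gamma * x r i j.
      by move: (M r *m x r) => A; rewrite !mxE.
    by rewrite /GRing.scale/=; ring.
  by apply/funext => s'; rewrite mxE.
have := HK y soly s t s0 t0; rewrite /y !normrZ.
rewrite (ger0_norm (expR_ge0 (gamma * s))) (ger0_norm (expR_ge0 (gamma * t))).
rewrite -ler_pdivlMl ?expR_gt0// -expRN => /le_trans; apply.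
rewrite [leRHS](_ : _ = K * expR (m * (t - s) + eps * `|t - s|) *
   (expR (- (gamma * t)) * expR (gamma * s)) * `|x s|).
  by rewrite le_eqVlt; apply/orP; left; apply/eqP; ring.
congr (_ * _); rewrite -mulrA -!expRD; congr (_ * expR _); ring.
Qed.

(** A vector killed by [Phi t] is the value at 0 of a solution that vanishes at
[t]; the estimate from [t] back to 0 makes it zero. *)
Lemma unitmx_linear_solution (m : R) (Phi : R -> 'M[R]_n) :
  bohl_exponent M m -> linear_solution M Phi -> Phi 0 = 1%:M ->
  forall t : R, 0 <= t -> Phi t \in unitmx.
Proof.
move=> bM sPhi Phi0 t t0; have [K _ HK] := bM 1 ltr01.
rewrite -unitmx_tr -row_free_unit; apply: inj_row_free => v vPhi.
have := HK _ (linear_solution_mulmxr v^T sPhi) t 0 t0 (lexx _).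
rewrite Phi0 mul1mx -{1}[Phi t]trmxK -trmx_mul vPhi trmx0 normr0 mulr0.
by rewrite normr_le0 => /eqP /(congr1 trmx); rewrite trmxK trmx0.
Qed.

(** The columns of [Phi t *m invmx (Phi s)] are the values at [t] of the
solutions that pass through the basis vectors at time [s]. *)
Lemma transition_bound (m : R) (Phi : R -> 'M[R]_n) :
  bohl_exponent M m -> linear_solution M Phi ->
  (forall t : R, 0 <= t -> Phi t \in unitmx) ->
  forall eps : R, 0 < eps -> exists2 K : R, 1 <= K &
    forall t s : R, 0 <= t -> 0 <= s ->
      `|Phi t *m invmx (Phi s)| <= K * expR (m * (t - s) + eps * `|t - s|).
Proof.
move=> bM sPhi uPhi eps eps0; have [K K1 HK] := bM eps eps0; exists K => //.
have K0 : 0 <= K by rewrite (le_trans _ K1).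
move=> t s t0 s0; apply: norm_mx_le => [|i j].
  by rewrite mulr_ge0 ?expR_ge0.
pose y := invmx (Phi s) *m delta_mx j (0 : 'I_1).
have := HK _ (linear_solution_mulmxr y sPhi); rewrite {}/y.
move=> /(_ s t s0 t0); rewrite !mulmxA mulmxV ?uPhi// mul1mx -colE => H.
have := entry_le_norm (col j (Phi t *m invmx (Phi s))) i 0.
rewrite mxE => /le_trans; apply; apply: (le_trans H).
rewrite ler_piMr ?mulr_ge0 ?expR_ge0//.
apply: norm_mx_le => // k l; rewrite mxE.
by case: (_ && _); rewrite ?normr1 ?normr0.
Qed.

End linear_solutions.

Section spectrum.
Context (R : realType) (n : nat).
Notation Rplus := (`[0, +oo[%R : interval R).

Lemma fundamental_matrix_exists (M : R -> 'M[R]_n) (m c : R) :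
  continuous M -> (forall t : R, 0 <= t -> `|M t| <= c) -> bohl_exponent M m ->
  exists Phi, [/\ fundamental_matrix Rplus M Phi, linear_solution M Phi
    & forall t : R, 0 <= t -> Phi t \in unitmx].
Proof.
move=> cM Mc bM.
have [Phi [sPhi Phi0]] := linear_solution_exists (1%:M : 'M[R]_n) cM Mc.
have uPhi := unitmx_linear_solution bM sPhi Phi0.
by exists Phi; split => //; exact: fundamental_linear_solution.
Qed.

Lemma exp_dichotomy_stable (M : R -> 'M[R]_n) (m c : R) :
  continuous M -> (forall t : R, 0 <= t -> `|M t| <= c) -> bohl_exponent M m ->
  m < 0 -> exp_dichotomy_with Rplus M 1%:M.
Proof.
move=> cM Mc bM m0; split; first by rewrite mulmx1.
have [Phi [fPhi sPhi uPhi]] := fundamental_matrix_exists cM Mc bM.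
(* Half of the rate is spent on absorbing the subexponential factor. *)
have m2 : 0 < - m / 2 by rewrite divr_gt0// oppr_gt0.
have [K K1 HK] := transition_bound bM sPhi uPhi m2.
exists Phi; split => //; exists K, (- m / 2); split => // t s.
all: rewrite !in_itv/= !andbT => t0 s0 ts.
  rewrite mulmx1 (le_trans (HK t s t0 s0))// ler_wpM2l ?(le_trans _ K1)//.
  by rewrite ler_expR ger0_norm ?subr_ge0//; lra.
by rewrite subrr mulmx0 mul0mx normr0 mulr_ge0 ?expR_ge0// (le_trans _ K1).
Qed.

Lemma exp_dichotomy_unstable (M : R -> 'M[R]_n) (m c : R) :
  continuous M -> (forall t : R, 0 <= t -> `|M t| <= c) -> bohl_exponent M m ->
  0 < m -> exp_dichotomy_with Rplus M 0.
Proof.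
move=> cM Mc bM m0; split; first by rewrite mulmx0.
have [Phi [fPhi sPhi uPhi]] := fundamental_matrix_exists cM Mc bM.
have m2 : 0 < m / 2 by rewrite divr_gt0.
have [K K1 HK] := transition_bound bM sPhi uPhi m2.
exists Phi; split => //; exists K, (m / 2); split => // t s.
all: rewrite !in_itv/= !andbT => t0 s0 ts.
  by rewrite mulmx0 mul0mx normr0 mulr_ge0 ?expR_ge0// (le_trans _ K1).
rewrite subr0 mulmx1 (le_trans (HK t s t0 s0))// ler_wpM2l ?(le_trans _ K1)//.
by rewrite ler_expR ler0_norm ?subr_le0//; lra.
Qed.

Lemma norm_decay_eq0 p q (A : 'M[R]_(p, q)) (c alpha : R) : 0 < alpha ->
  (forall t : R, 0 <= t -> `|A| <= c * expR (- (alpha * t))) -> A = 0.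
Proof.
move=> a0 Ac; apply/eqP; rewrite -normr_le0.
have c0 : 0 <= c.
  by have := Ac 0 (lexx _); rewrite mulr0 oppr0 expR0 mulr1; apply: le_trans.
apply/ler_addgt0Pl => e e0; rewrite addr0.
pose t := c / (alpha * e).
have t0 : 0 <= t by rewrite divr_ge0// ltW// mulr_gt0.
apply: (le_trans (Ac t t0)).
have : 1 + alpha * t <= expR (alpha * t) by exact: expR_ge1Dx.
have at0 : 0 <= alpha * t by rewrite mulr_ge0// ltW.
move=> H; rewrite expRN ler_pdivrMr ?expR_gt0//.
apply: (@le_trans _ _ (e * (1 + alpha * t))); last by rewrite ler_wpM2l// ltW.
have -> : e * (1 + alpha * t) = e + c.
  by rewrite /t; field; rewrite !gt_eqF.
by rewrite lerDr ltW.
Qed.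

(** With [T(t, s) = Phi t *m invmx (Phi s)], write
[Phi(0) P Phi(0)^-1 = T(0, t) (Phi(t) P Phi(0)^-1)]: the second factor decays
like [exp(-alpha t)] and the first one grows at most like [exp(alpha t / 2)],
so the product is 0 and [P = 0]. In the same way [I - P = 0], which is absurd in
positive dimension. *)
Lemma no_dichotomy_zero (M : R -> 'M[R]_n) : (0 < n)%N ->
  continuous M -> bohl_exponent M 0 -> ~ exp_dichotomy Rplus M.
Proof.
move=> n0 cM bM [P [_ [Phi [fPhi [K [alpha [K1 a0 stab unst]]]]]]].
have sPhi := linear_solution_fundamental cM fPhi.
have uPhi (t : R) : 0 <= t -> Phi t \in unitmx.
  by move=> t0; case: fPhi => + _ _; apply; rewrite in_itv/= t0.
have a2 : 0 < alpha / 2 by rewrite divr_gt0.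
have [K' K'1 HK'] := transition_bound bM sPhi uPhi a2.
have J0 : 0 \in Rplus by rewrite in_itv/= lexx.
have decay (t : R) : expR (alpha / 2 * t) * expR (- (alpha * t)) =
    expR (- (alpha / 2 * t)) by rewrite -expRD; congr expR; field.
have P0 : Phi 0 *m P *m invmx (Phi 0) = 0.
  apply: (@norm_decay_eq0 _ _ _ (n%:R * K' * K) (alpha / 2)) => // t t0.
  have -> : Phi 0 *m P *m invmx (Phi 0) =
      (Phi 0 *m invmx (Phi t)) *m (Phi t *m P *m invmx (Phi 0)).
    by rewrite -!mulmxA (mulKmx (uPhi t t0)).
  apply: (le_trans (norm_mulmx_le _ _)); rewrite -decay.
  have := HK' 0 t (lexx _) t0.
  rewrite mul0r add0r sub0r normrN ger0_norm// => H1.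
  have := stab t 0 _ J0 t0; rewrite in_itv/= t0 subr0 => /(_ isT) H2.
  rewrite [leRHS](_ : _ = n%:R * (K' * expR (alpha / 2 * t)) *
    (K * expR (- (alpha * t)))); last by ring.
  by apply: ler_pM => //; rewrite ?mulr_ge0// ler_wpM2l.
have P1 : Phi 0 *m (1%:M - P) *m invmx (Phi 0) = 0.
  apply: (@norm_decay_eq0 _ _ _ (n%:R * K * K') (alpha / 2)) => // t t0.
  have -> : Phi 0 *m (1%:M - P) *m invmx (Phi 0) =
      (Phi 0 *m (1%:M - P) *m invmx (Phi t)) *m (Phi t *m invmx (Phi 0)).
    by rewrite -!mulmxA (mulKmx (uPhi t t0)).
  apply: (le_trans (norm_mulmx_le _ _)); rewrite -decay.
  have := HK' t 0 t0 (lexx _).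
  rewrite mul0r add0r subr0 ger0_norm// => H1.
  have := unst 0 t J0 _ t0; rewrite in_itv/= t0 subr0 => /(_ isT) H2.
  rewrite [leRHS](_ : _ = n%:R * (K * expR (- (alpha * t))) *
    (K' * expR (alpha / 2 * t))); last by ring.
  by apply: ler_pM => //; rewrite ?mulr_ge0// ler_wpM2l.
have : (1%:M : 'M[R]_n) = 0.
  rewrite -[LHS](mulmxV (uPhi 0 (lexx _))) -[Phi 0 in X in X *m _]mulmx1.
  by rewrite -[1%:M](subrK P) mulmxDr mulmxDl P1 P0 addr0.
move=> /matrixP /(_ (Ordinal n0) (Ordinal n0)); rewrite !mxE eqxx => /eqP.
by rewrite oner_eq0.
Qed.

Theorem ED_spectrum_plus_bohl (M : R -> 'M[R]_n) (m c : R) : (0 < n)%N ->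
  continuous M -> (forall t : R, 0 <= t -> `|M t| <= c) -> bohl_exponent M m ->
  ED_spectrum_plus M = [set m].
Proof.
move=> n0 cM Mc bM.
have cMg gamma : continuous (fun t => M t - gamma%:M).
  by move=> t; apply: cvgB; [exact: cM|exact: cvg_cst].
have Mgc gamma (t : R) : 0 <= t ->
    `|M t - gamma%:M| <= c + `|gamma%:M : 'M[R]_n|.
  by move=> t0; rewrite (le_trans (ler_normB _ _))// lerD2r Mc.
apply/seteqP; split => gamma /=.
  move=> noED; apply: contrapT => /eqP; rewrite neq_lt.
  move=> /orP[gm|mg]; apply: noED.
    exists 0; apply: (exp_dichotomy_unstable (cMg gamma) (Mgc gamma)
      (bohl_exponent_shift gamma bM)).
    by rewrite subr_gt0.
  exists 1%:M; apply: (exp_dichotomy_stable (cMg gamma) (Mgc gamma)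
      (bohl_exponent_shift gamma bM)).
  by rewrite subr_lt0.
move=> ->; apply: no_dichotomy_zero => //.
by rewrite -[0](subrr m); exact: bohl_exponent_shift.
Qed.

End spectrum.

(** * The vector field *)

(** [p] is Lipschitz at 0 on bounded sets; this turns the decay of [z(t)] into
exponential convergence of the coefficients. *)
Lemma horner_dist0_le (R : realType) (p : {poly R}) (A : R) : 0 <= A ->
  exists2 c : R, 0 <= c & forall z, `|z| <= A -> `|p.[z] - p.[0]| <= c * `|z|.
Proof.
move=> A0; elim/poly_ind: p => [|q r [c c0 qc]].
  by exists 0 => // z _; rewrite !horner0 subrr normr0 mul0r.
exists (c * A + `|q.[0]|) => [|z zA]; first by rewrite addr_ge0 ?mulr_ge0.
rewrite !hornerE addrK normrM ler_wpM2r//.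
rewrite -[q.[z]](subrK q.[0]) (le_trans (ler_normD _ _))// lerD2r.
by rewrite (le_trans (qc z zA))// ler_wpM2l.
Qed.

Definition eval_mx (R : realType) m n (P : 'M[{poly R}]_(m, n)) (z : R) :
  'M[R]_(m, n) := map_mx (horner_eval z) P.

Lemma eval_mx_dist0_le (R : realType) m n (P : 'M[{poly R}]_(m, n)) (A : R) :
  0 <= A -> exists2 c : R, 0 <= c &
    forall z, `|z| <= A -> `|eval_mx P z - eval_mx P 0| <= c * `|z|.
Proof.
move=> A0.
have H i j : exists c : R, 0 <= c /\
    forall z, `|z| <= A -> `|(P i j).[z] - (P i j).[0]| <= c * `|z|.
  by have [c c0 cP] := horner_dist0_le (P i j) A0; exists c.
pose C i j := projT1 (cid (H i j)).
have C0 i j : 0 <= C i j by rewrite /C; case: cid => c [].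
have CP i j z : `|z| <= A -> `|(P i j).[z] - (P i j).[0]| <= C i j * `|z|.
  by rewrite /C; case: cid => c [] /= _; exact.
have Cmax i j : C i j <= \sum_k \sum_l C k l.
  rewrite (bigD1 i)//= (bigD1 j)//= -addrA lerDl addr_ge0//.
    exact: sumr_ge0.
  by apply: sumr_ge0 => k _; exact: sumr_ge0.
have S0 : 0 <= \sum_k \sum_l C k l.
  by apply: sumr_ge0 => k _; exact: sumr_ge0.
exists (\sum_k \sum_l C k l) => // z zA.
apply: norm_mx_le => [|i j]; first exact: mulr_ge0.
rewrite !mxE /horner_eval (le_trans (CP i j z zA))// ler_wpM2r//.
Qed.

(** The matrix of [u |-> g (a x + b y) (-b, a)], kept over the polynomials so
that its square vanishes identically in [z]. *)
Definition shear_mx (R : realType) (a b g : {poly R}) : 'M[{poly R}]_2 :=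
  g *: ((\col_(i < 2) [:: - b; a]`_i) *m (\row_(j < 2) [:: a; b]`_j)).

Lemma shear_mx_sqr0 (R : realType) (a b g : {poly R}) :
  shear_mx a b g *m shear_mx a b g = 0.
Proof.
rewrite /shear_mx; set v := \col__ _; set w := \row__ _.
have wv0 : w *m v = 0.
  by apply/matrixP => i j; rewrite !mxE !big_ord_recl big_ord0 !mxE/=; ring.
rewrite -scalemxAl -scalemxAr mulmxA -[v *m w *m v]mulmxA wv0.
by rewrite mulmx0 mul0mx !scaler0.
Qed.

Definition plane_part (R : realType) (p : 'cV[R]_3) : 'cV[R]_2 :=
  \col_(i < 2) p (widen_ord (leqnSn 2) i) 0.

Lemma pt3_plane_part (R : realType) (p : 'cV[R]_3) :
  pt3 (plane_part p) (p 2 0) = p.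
Proof.
apply/matrixP => i j; rewrite !ord1 !mxE.
by case: i => -[|[|[|//]]] ? /=; rewrite ?mxE; congr (p _ _); apply: val_inj.
Qed.

Lemma plane_part_pt3 (R : realType) (u : 'cV[R]_2) (z : R) :
  plane_part (pt3 u z) = u.
Proof.
apply/matrixP => i j; rewrite !ord1 !mxE.
by case: i => -[|[|//]] ? /=; congr (u _ _); apply: val_inj.
Qed.

Lemma pt3E2 (R : realType) (u : 'cV[R]_2) (z : R) : pt3 u z 2 0 = z.
Proof. by rewrite mxE. Qed.

Section field.
Context (R : realType) (lambda : R) (a b g : {poly R}).
Context (F : 'cV[R]_3 -> 'cV[R]_3).
Hypothesis hF : forall p, F p = lambda *: p + Hfield a b g p.
Hypothesis hlambda : lambda < 0.

Definition plane_coef (z : R) : 'M[R]_2 :=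
  lambda%:M + eval_mx (shear_mx a b g) z.

(** The source of the correspondence between solutions of the nonlinear field
and solutions of the linear systems over the heights [z0 exp(lambda t)]. *)
Lemma field_pt3 u z : F (pt3 u z) = pt3 (plane_coef z *m u) (lambda * z).
Proof.
have o0 : (0 : 'I_2) = ord0 by apply: val_inj.
have o1 : lift ord0 ord0 = 1 :> 'I_2 by apply: val_inj.
rewrite hF /Hfield; apply/matrixP => i j; rewrite !ord1.
case: i => -[|[|[|//]]] ilt; rewrite ?(mxE, big_ord_recl, big_ord0)/=;
  rewrite ?(mxE, big_ord_recl, big_ord0)/= /horner_eval ?hornerE/= -?o0 ?o1;
  ring.
Qed.

Definition orbit_coef (z0 t : R) : 'M[R]_2 :=
  plane_coef (z0 * expR (lambda * t)).

Lemma expRM_le1 (t : R) : 0 <= t -> expR (lambda * t) <= 1.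
Proof. by move=> t0; rewrite -expR0 ler_expR mulr_le0_ge0// ltW. Qed.

Lemma orbit_coef_limit z0 : exists2 c : R, 0 <= c & forall t : R, 0 <= t ->
  `|orbit_coef z0 t - lambda%:M - eval_mx (shear_mx a b g) 0|
    <= c * expR (lambda * t).
Proof.
have [c c0 cP] := eval_mx_dist0_le (shear_mx a b g) (normr_ge0 z0).
exists (c * `|z0|) => [|t t0]; first exact: mulr_ge0.
rewrite /orbit_coef /plane_coef [lambda%:M + _]addrC addrK.
have nz : `|z0 * expR (lambda * t)| = `|z0| * expR (lambda * t).
  by rewrite normrM (ger0_norm (expR_ge0 _)).
rewrite -mulrA -nz; apply: cP; rewrite nz ler_piMr//.
exact: expRM_le1.
Qed.

Lemma orbit_coef_bohl z0 : bohl_exponent (orbit_coef z0) lambda.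
Proof.
have [c c0 cP] := orbit_coef_limit z0.
apply: (bohl_exponent_of_limit hlambda _ cP).
by rewrite /eval_mx -map_mxM shear_mx_sqr0 map_mx0.
Qed.

Lemma orbit_coef_bounded z0 :
  exists c : R, forall t : R, 0 <= t -> `|orbit_coef z0 t| <= c.
Proof.
have [c c0 cP] := orbit_coef_limit z0.
pose N := lambda%:M + eval_mx (shear_mx a b g) 0.
exists (c + `|N|) => t t0; rewrite -[orbit_coef z0 t](subrK N).
rewrite (le_trans (ler_normD _ _))// lerD2r /N opprD addrA.
rewrite (le_trans (cP t t0))// ler_piMr//.
exact: expRM_le1.
Qed.

Lemma orbit_coef_continuous z0 : continuous (orbit_coef z0).
Proof.
move=> t; apply/cvg_entries => i j.
have E s : orbit_coef z0 s i j = (lambda%:M : 'M[R]_2) i j +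
    (shear_mx a b g i j).[z0 * expR (lambda * s)].
  by rewrite /orbit_coef /plane_coef mxE [eval_mx _ _ _ _]mxE.
rewrite E (funext E); apply: cvgD; first exact: cvg_cst.
apply: (@cvg_comp _ _ _ (fun s => z0 * expR (lambda * s))); last first.
  exact: continuous_horner.
by apply: cvgM; [exact: cvg_cst|exact: continuous_expRM].
Qed.

Lemma is_derive_height (z0 t : R) :
  is_derive t 1 (fun s => z0 * expR (lambda * s))
    (lambda * (z0 * expR (lambda * t))).
Proof.
have de := is_derive_expRM lambda t.
rewrite (_ : (fun s => _) = z0 *: (fun s => expR (lambda * s)))//.
by apply: is_derive_eq; rewrite /GRing.scale/=; ring.
Qed.

Lemma continuous_height (z0 : R) :
  continuous (fun s : R => z0 * expR (lambda * s)).
Proof. by move=> t; exact: is_derive_continuous (is_derive_height z0 t). Qed.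

Lemma orbit_coef_related z0 : related_system F z0 (orbit_coef z0).
Proof.
exists (fun t => z0 * expR (lambda * t)); split.
- by rewrite mulr0 expR0 mulr1.
- by apply: continuous_subspaceT; exact: continuous_height.
- by move=> t u _; rewrite field_pt3 pt3E2; exact: is_derive_height.
- by move=> t u _; rewrite field_pt3 -/(plane_part _) plane_part_pt3.
Qed.

Lemma solution_of_plane z0 (u : R -> 'cV[R]_2) :
  linear_solution (orbit_coef z0) u ->
  solution_Rplus F (fun t => pt3 (u t) (z0 * expR (lambda * t))).
Proof.
move=> [cu du]; split.
  move/continuous_entries : cu => cu; apply/continuous_entries => i j.
  rewrite !ord1; case: i => -[|[|[|//]]] ilt.
  - rewrite (_ : (fun s => _) = (fun s => u s 0 0))//.
    by apply/funext => s; rewrite mxE.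
  - rewrite (_ : (fun s => _) = (fun s => u s 1 0))//.
    by apply/funext => s; rewrite mxE.
  - rewrite (_ : (fun s => _) = (fun s => z0 * expR (lambda * s))).
      by apply: continuous_subspaceT; exact: continuous_height.
    by apply/funext => s; rewrite mxE.
move=> t t0; have /is_derive_entries dut := du t t0.
rewrite field_pt3; apply/is_derive_entries => i j.
rewrite !ord1; case: i => -[|[|[|//]]] ilt; rewrite mxE/=.
- rewrite (_ : (fun s => _) = (fun s => u s 0 0)); first exact: dut.
  by apply/funext => s; rewrite mxE.
- rewrite (_ : (fun s => _) = (fun s => u s 1 0)); first exact: dut.
  by apply/funext => s; rewrite mxE.
- rewrite (_ : (fun s => _) = (fun s => z0 * expR (lambda * s))).
    exact: is_derive_height.
  by apply/funext => s; rewrite mxE.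
Qed.

(** Uniqueness for [z' = lambda z], from the two Gronwall inequalities with
equality in their hypotheses. *)
Lemma solution_height X : solution_Rplus F X ->
  forall t : R, 0 <= t -> X t 2 0 = X 0 2 0 * expR (lambda * t).
Proof.
move=> [cX dX] t t0.
have cz : {within `[0, +oo[, continuous (fun t => X t 2 0)}.
  by move/continuous_entries : cX; exact.
have dz (r : R) : 0 < r -> is_derive r 1 (fun t => X t 2 0) (lambda * X r 2 0).
  move=> r0; have /is_derive_entries /(_ 2 0) := dX r r0.
  by rewrite -[F _]/(F (X r)) -{1}(pt3_plane_part (X r)) field_pt3 pt3E2.
pose h (r : R) : R := 1 * (lambda * r).
have dh (r : R) : 0 < r -> is_derive r 1 h lambda.
  move=> _; rewrite (_ : h = lambda *: id); last first.
    by apply/funext => s; rewrite /h mul1r.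
  by apply: is_derive_eq; rewrite /GRing.scale/= mulr1.
have ch : {within `[0, +oo[, continuous h}.
  apply: continuous_subspaceT => r.
  by apply: cvgM; [exact: cvg_cst|apply: cvgM; [exact: cvg_cst|exact: cvg_id]].
have hE : h t - h 0 = lambda * t by rewrite /h; ring.
apply/eqP; rewrite eq_le -hE.
rewrite (gronwall_upper cz ch dz dh _ (lexx _) t0)//.
by rewrite (gronwall_lower cz ch dz dh _ (lexx _) t0).
Qed.

Lemma plane_of_solution X : solution_Rplus F X ->
  linear_solution (orbit_coef (X 0 2 0)) (fun t => plane_part (X t)).
Proof.
move=> sX; have zE := solution_height sX; case: sX => cX dX; split.
  move/continuous_entries : cX => cX; apply/continuous_entries => i j.
  rewrite (_ : (fun s => _) = (fun s => X s (widen_ord (leqnSn 2) i) 0))//.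
  by apply/funext => s; rewrite mxE.
move=> t t0; have /is_derive_entries dXt := dX t t0.
apply/is_derive_entries => i j.
rewrite (_ : (fun s => _) =
    (fun s => X s (widen_ord (leqnSn 2) i) 0)); last first.
  by apply/funext => s; rewrite mxE.
apply: is_derive_eq (dXt _ _) _.
rewrite -{1}[X t]pt3_plane_part field_pt3 (zE t (ltW t0)) -/(orbit_coef _ t).
rewrite ord1 -[in RHS](plane_part_pt3
  (orbit_coef (X 0 2 0) t *m plane_part (X t))
  (lambda * (X 0 2 0 * expR (lambda * t)))).
by rewrite [in RHS]mxE.
Qed.

Lemma origin_attracts : origin_global_attractor F.
Proof.
split=> [p|X sX].
  have [c cP] := orbit_coef_bounded (p 2 0).
  have [u [su u0]] := linear_solution_exists (plane_part p)
    (orbit_coef_continuous (z0 := p 2 0)) cP.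
  exists (fun t => pt3 (u t) (p 2 0 * expR (lambda * t))).
  split; first exact: solution_of_plane.
  by rewrite u0 mulr0 expR0 mulr1 pt3_plane_part.
have l2 : 0 < - lambda / 2 by rewrite divr_gt0// oppr_gt0.
have [K K1 HK] := orbit_coef_bohl (X 0 2 0) l2.
have K0 : 0 <= K by rewrite (le_trans _ K1).
have su := plane_of_solution sX; have zE := solution_height sX.
pose B := K * `|plane_part (X 0)| + `|X 0 2 0|.
have B0 : 0 <= B by rewrite addr_ge0// mulr_ge0.
have XB (t : R) : 0 <= t -> `|X t| <= B * expR (- (- lambda / 2 * t)).
  move=> t0; apply: norm_mx_le => [|i j]; first by rewrite mulr_ge0 ?expR_ge0.
  have eE : expR (lambda * (t - 0) + - lambda / 2 * `|t - 0|) =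
      expR (- (- lambda / 2 * t)).
    by rewrite subr0 ger0_norm//; congr expR; field.
  have := HK _ su 0 t (lexx _) t0; rewrite eE => uB.
  have ule k : `|plane_part (X t) k 0| <= B * expR (- (- lambda / 2 * t)).
    apply: (le_trans (entry_le_norm _ _ _)); apply: (le_trans uB).
    by rewrite mulrAC ler_wpM2r ?expR_ge0// lerDl.
  have zle : `|X t 2 0| <= B * expR (- (- lambda / 2 * t)).
    rewrite (zE t t0) normrM (ger0_norm (expR_ge0 _)).
    apply: ler_pM; rewrite ?expR_ge0//; first by rewrite lerDr mulr_ge0.
    by rewrite ler_expR; nra.
  rewrite -[X t]pt3_plane_part ord1 mxE.
  by case: i => -[|[|[|//]]] ilt /=; rewrite ?zle ?ule.
apply/cvgr0Pnorm_le => e e0.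
have cv : B * expR (- (- lambda / 2 * t)) @[t --> +oo] --> (0 : R).
  rewrite -[X in _ --> X](mulr0 B); apply: cvgM; first exact: cvg_cst.
  apply: (@cvg_comp _ _ _ (fun t => - lambda / 2 * t) (fun t => expR (- t)));
    last exact: cvgr_expR.
  by apply: (gt0_cvgMry l2); exact: cvg_id.
move/cvgr0Pnorm_le : cv => /(_ e e0) cv; near=> t.
have t0 : 0 <= t by near: t; exact: nbhs_pinfty_ge.
apply: (le_trans (XB t t0)); apply: (le_trans (ler_norm _)).
by near: t.
Unshelve. all: by end_near. Qed.

End field.

Theorem theorem3 (R : realType) (lambda : R) (a b g : {poly R})
    (F : 'cV[R]_3 -> 'cV[R]_3)
    (hF : forall p, F p = lambda *: p + Hfield a b g p)
    (hlambda : lambda < 0) (hF0 : F 0 = 0) :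
  (forall z0 : R, exists C : R -> 'M[R]_2,
    [/\ related_system F z0 C,
        locally_integrable_mx `[0, +oo[%R C,
        exp_dichotomy_with `[0, +oo[%R C 1%:M
      & ED_spectrum_plus C = [set lambda]])
  /\ origin_global_attractor F.
Proof.
split; last exact: origin_attracts hF hlambda.
move=> z0; exists (orbit_coef lambda a b g z0).
have cC : continuous (orbit_coef lambda a b g z0).
  exact: orbit_coef_continuous.
have bC := orbit_coef_bohl a b g hlambda z0.
have [c cP] := orbit_coef_bounded a b g hlambda z0.
split.
- exact: orbit_coef_related.
- by move=> s t _ _ i j; exact: integrable_entry.
- exact: exp_dichotomy_stable cC cP bC hlambda.
- exact: ED_spectrum_plus_bohl cC cP bC.
Qed.
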